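(* Let $(M,P)$ be a holomorphic Poisson manifold of complex dimension $n$ endowed with a holomorphic volume form $\omega$, and write $P=P_{\mathbb{R}}+iP_{\mathbb{I}}$ with $P_{\mathbb{R}},P_{\mathbb{I}}$ the real and imaginary parts of $P$, which are real Poisson structures on the underlying real manifold. A holomorphic function $f\in\mathcal{O}(M)$ is a holomorphic last multiplier for its holomorphic Hamiltonian vector field $Z_f$ if and only if $|f|^2$ is a real last multiplier for both real Hamiltonian vector fields $Z^{\mathbb{R}}_{|f|^2}$ and $Z^{\mathbb{I}}_{|f|^2}$.
   Context: A holomorphic Poisson structure on a complex manifold $M$ is a holomorphic bivector field $P\in\Gamma(\bigwedge^2T^{1,0}M)$, $\overline\partial P=0$, with $[P,P]=0$ (Schouten–Nijenhuis bracket); the bracket is $\{f,g\}=P(\partial f,\partial g)$. The holomorphic Hamiltonian vector field of a holomorphic function $f$ is $Z_f=\{f,\cdot\}$, locally $Z_f=\sum_{i,j}P^{ij}\frac{\partial f}{\partial z^i}\frac{\partial}{\partial z^j}$ with $P^{ij}=\{z^i,z^j\}$. With $z^j=x^j+ix^{n+j}$, the real Poisson structures $P_{\mathbb{R}}$, $P_{\mathbb{I}}$ are given by $\{x^i,x^j\}_{\mathbb{R}}=\frac14\mathrm{Re}\{z^i,z^j\}$, $\{x^i,x^{n+j}\}_{\mathbb{R}}=\frac14\mathrm{Im}\{z^i,z^j\}$, $\{x^{n+i},x^{n+j}\}_{\mathbb{R}}=-\frac14\mathrm{Re}\{z^i,z^j\}$, and $\{x^i,x^j\}_{\mathbb{I}}=\frac14\mathrm{Im}\{z^i,z^j\}$,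 $\{x^i,x^{n+j}\}_{\mathbb{I}}=-\frac14\mathrm{Re}\{z^i,z^j\}$, $\{x^{n+i},x^{n+j}\}_{\mathbb{I}}=-\frac14\mathrm{Im}\{z^i,z^j\}$. For a smooth real function $u$, $Z^{\mathbb{R}}_u=\{u,\cdot\}_{\mathbb{R}}$ and $Z^{\mathbb{I}}_u=\{u,\cdot\}_{\mathbb{I}}$ are its real Hamiltonian vector fields. A holomorphic volume form is a nowhere vanishing holomorphic $n$-form. $\alpha\in\mathcal{O}(M)$ is a holomorphic last multiplier for a holomorphic vector field $Z$ if $\partial(\alpha\,\imath_Z\omega)=0$, where $d=\partial+\overline\partial$. $m\in C^\infty(M;\mathbb{R})$ is a real last multiplier for a real vector field $X$ if $d(m\,\imath_X(\omega\wedge\overline{\omega}))=0$. *)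

(* Defs.v *)
From HB Require Import structures.
From mathcomp Require Import all_boot all_order all_algebra all_fingroup.
From mathcomp Require Import complex.
From mathcomp Require Import all_classical all_reals all_analysis.
From mathcomp Require Import ring.

Set Implicit Arguments.
Unset Strict Implicit.
Unset Printing Implicit Defensive.

Import Order.TTheory GRing.Theory Num.Theory.
Import numFieldNormedType.Exports.

Local Open Scope classical_set_scope.
Local Open Scope ring_scope.
Local Open Scope complex_scope.

Local Notation Re := complex.Re.
Local Notation Im := complex.Im.
Local Notation normc := ComplexField.Normc.normc.

(* The local model is C^n with its real coordinates (x^1, ..., x^(2n)), where  *)
(* z^j = x^j + i x^(n+j): x^j is indexed by [lshift n j] and x^(n+j) by        *)
(* [rshift n j].  Complexified tangent vectors are row vectors over R[i],      *)
(* written in the basis d/dx^a.                                                *)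

Section Model.
Variables (R : realType) (n : nat).

Definition cspace := 'rV[R]_(n + n).
Definition ctangent := 'rV[R[i]]_(n + n).

Implicit Types (U : set cspace) (u : cspace -> R) (g : cspace -> R[i]).

Fixpoint Ck (k : nat) U u : Prop :=
  match k with
  | 0%N => forall x, U x -> {for x, continuous u}
  | k'.+1 => (forall x, U x -> differentiable u x) /\
             (forall v : cspace, Ck k' U ('D_v u))
  end.

Definition smooth U u := forall k, Ck k U u.

Definition csmooth U g :=
  smooth U (fun x => Re (g x)) /\ smooth U (fun x => Im (g x)).

Definition partial (a : 'I_(n + n)) u : cspace -> R := 'D_(delta_mx 0 a) u.

Definition cpartial (a : 'I_(n + n)) g : cspace -> R[i] := fun x =>
  partial a (fun y => Re (g y)) x +i* partial a (fun y => Im (g y)) x.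

Definition cderive (v : ctangent) g : cspace -> R[i] := fun x =>
  \sum_a v 0 a * cpartial a g x.

Definition ddz (j : 'I_n) : ctangent :=
  2%:R^-1 *: (delta_mx 0 (lshift n j) - 'i *: delta_mx 0 (rshift n j)).
Definition ddzbar (j : 'I_n) : ctangent :=
  2%:R^-1 *: (delta_mx 0 (lshift n j) + 'i *: delta_mx 0 (rshift n j)).

Definition dz (j : 'I_n) (v : ctangent) : R[i] :=
  v 0 (lshift n j) + 'i * v 0 (rshift n j).
Definition dzbar (j : 'I_n) (v : ctangent) : R[i] :=
  v 0 (lshift n j) - 'i * v 0 (rshift n j).

Definition part10 (v : ctangent) : ctangent := \sum_j dz j v *: ddz j.
Definition part01 (v : ctangent) : ctangent := \sum_j dzbar j v *: ddzbar j.

Lemma part10D01 v : v = part10 v + part01 v.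
Proof.
apply/rowP => a; rewrite !mxE !summxE -big_split /=.
have i2 : 'i * 'i = -1 :> R[i] by rewrite -expr2 sqr_i.
have two : 2%:R^-1 + 2%:R^-1 = 1 :> R[i] by field.
rewrite -[a](splitK a); case: (fintype.split a) => j /=; rewrite (bigD1 j) //=;
  rewrite [X in _ + X]big1 => [|k kj];
  rewrite !mxE ?eq_lrshift ?eq_rlshift ?eqxx
    ?(inj_eq (@lshift_inj _ _)) ?(inj_eq (@rshift_inj _ _))
    ?(eq_sym j k) ?(negPf kj) /dz /dzbar /=; ring: i2 two.
Qed.

Definition holomorphic U g :=
  csmooth U g /\ forall j x, U x -> cderive (ddzbar j) g x = 0.

(* Complex-valued k-forms; the k arguments are the rows of a matrix. *)
Definition form (k : nat) := cspace -> 'M[R[i]]_(k, n + n) -> R[i].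

Definition alternating k (eta : 'M[R[i]]_(k, n + n) -> R[i]) :=
  (forall (i : 'I_k) (v a b : 'M[R[i]]_(k, n + n)) (c : R[i]),
     row i v = c *: row i a + row i b ->
     row' i a = row' i v -> row' i b = row' i v ->
     eta v = c * eta a + eta b) /\
  (forall (v : 'M[R[i]]_(k, n + n)) (i j : 'I_k),
     i != j -> row i v = row j v -> eta v = 0).

Definition smooth_form U k (eta : form k) :=
  (forall x, U x -> alternating (eta x)) /\
  (forall v, csmooth U (fun x => eta x v)).

(* d, del and delbar, by the coordinate formula                               *)
(* (d eta)(v_0, ..., v_k) = sum_i (-1)^i D_(v_i) (eta (.., v_i omitted, ..))   *)
(* for constant vector fields v_i; del (resp. delbar) keeps only the           *)
(* derivatives along the (1,0) (resp. (0,1)) parts, since                      *)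
(* del eta = sum_j dz^j /\ (d eta / dz^j).                                     *)
Definition dform k (eta : form k) : form k.+1 := fun x v =>
  \sum_(i < k.+1) (-1) ^+ i * cderive (row i v) (fun y => eta y (row' i v)) x.

Definition del k (eta : form k) : form k.+1 := fun x v =>
  \sum_(i < k.+1)
    (-1) ^+ i * cderive (part10 (row i v)) (fun y => eta y (row' i v)) x.

Definition delbar k (eta : form k) : form k.+1 := fun x v =>
  \sum_(i < k.+1)
    (-1) ^+ i * cderive (part01 (row i v)) (fun y => eta y (row' i v)) x.

Definition holomorphic_form U k (eta : form k) :=
  [/\ smooth_form U eta,
      forall x v (i : 'I_k) j, U x -> row i v = ddzbar j -> eta x v = 0
    & forall x v, U x -> delbar eta x v = 0].

Definition scale k g (eta : form k) : form k := fun x v => g x * eta x v.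

(* the contraction of a 0-form is 0 *)
Definition interior (Z : cspace -> ctangent) (k : nat) : form k -> form k.-1 :=
  match k return form k -> form k.-1 with
  | 0%N => fun _ _ _ => 0
  | k'.+1 => fun eta x v => eta x (col_mx (Z x) v)
  end.

Definition conj_form k (eta : form k) : form k := fun x v =>
  conjc (eta x (map_mx conjc v)).

Definition wedge k l (eta : form k) (theta : form l) : form (k + l) := fun x v =>
  (k`! * l`!)%:R^-1 *
  \sum_(s : 'S_(k + l)) (-1) ^+ s *
     (eta x (usubmx (row_perm s v)) * theta x (dsubmx (row_perm s v))).

(* Bivector fields of type (2,0), P = 1/2 sum_ij P^ij d/dz^i /\ d/dz^j *)
Definition bivector := cspace -> 'M[R[i]]_n.

(* the components [P, Q]^ijk of the Schouten-Nijenhuis bracket *)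
Definition schouten (P Q : bivector) (i j k : 'I_n) : cspace -> R[i] := fun x =>
  let T (a b c : 'I_n) := \sum_l
    (P x l a * cderive (ddz l) (fun y => Q y b c) x +
     Q x l a * cderive (ddz l) (fun y => P y b c) x) in
  T i j k + T j k i + T k i j.

(* the components {x^a, x^b} of the real bivectors P_R and P_I; the lower left *)
(* blocks are {x^(n+i), x^j} = - {x^j, x^(n+i)}, with P^ji = - P^ij            *)
Definition realPoissonR (P : 'M[R[i]]_n) : 'M[R]_(n + n) :=
  4%:R^-1 *: block_mx (map_mx (@Re R) P) (map_mx (@Im R) P)
                      (map_mx (@Im R) P) (- map_mx (@Re R) P).
Definition realPoissonI (P : 'M[R[i]]_n) : 'M[R]_(n + n) :=
  4%:R^-1 *: block_mx (map_mx (@Im R) P) (- map_mx (@Re R) P)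
                      (- map_mx (@Re R) P) (- map_mx (@Im R) P).

(* P = P_R + i P_I: both sides are bivectors in the real coordinates *)
Lemma PoissonRDI (P : 'M[R[i]]_n) :
  let B : 'M[R[i]]_(n, n + n) := \matrix_(j, a) ddz j 0 a in
  B^T *m P *m B =
  map_mx (real_complex R) (realPoissonR P) +
  'i *: map_mx (real_complex R) (realPoissonI P).
Proof.
move=> B.
have -> : B = 2%:R^-1 *: row_mx 1%:M (- ('i *: 1%:M)).
  apply/matrixP => j a; rewrite [LHS]mxE /ddz.
  by rewrite -[a](splitK a); case: (fintype.split a) => k /=;
    rewrite [RHS]mxE ?row_mxEl ?row_mxEr !mxE ?eq_lrshift ?eq_rlshift
    ?(inj_eq (@lshift_inj _ _)) ?(inj_eq (@rshift_inj _ _)) (eq_sym j k) /=; ring.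
rewrite [X in X *m P]linearZ /= tr_row_mx [X in col_mx _ X]linearN /=.
rewrite [X in col_mx _ (- X)]linearZ /= !trmx1.
rewrite -!scalemxAl -scalemxAr scalerA mul_col_mx mul_col_row.
rewrite !mul1mx !mulmx1 !mulNmx !mulmxN -!scalemxAl -!scalemxAr.
rewrite !mul1mx !mulmx1 opprK scalerA -(expr2 'i) sqr_i.
rewrite /realPoissonR /realPoissonI.
rewrite !map_mxZ !map_block_mx !scale_block_mx add_block_mx.
have q : 2%:R^-1 * 2%:R^-1 = (4%:R^-1 : R)%:C :> R[i].
  by rewrite fmorphV rmorph_nat; field.
by rewrite q; congr block_mx; apply/matrixP => i j; rewrite !mxE;
  case: (P i j) => x y; simpc; congr (_ +i* _); ring.
Qed.

(* Z_f = sum_ij P^ij (df/dz^i) d/dz^j *)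
Definition hamiltonian (P : bivector) g : cspace -> ctangent := fun x =>
  \sum_i \sum_j (P x i j * cderive (ddz i) g x) *: ddz j.

(* {u, .} = sum_ab {x^a, x^b} (du/dx^a) d/dx^b *)
Definition real_hamiltonian (Q : cspace -> 'M[R]_(n + n)) u
    : cspace -> cspace := fun x =>
  \sum_a \sum_b (Q x a b * partial a u x) *: delta_mx 0 b.

End Model.

Record chart (R : realType) (n : nat) (M : topologicalType) := Chart {
  dom : set M;
  coord : M -> cspace R n;
  param : cspace R n -> M;
  dom_open : open dom;
  coord_open : open (coord @` dom);
  coordK : forall p, dom p -> param (coord p) = p;
  coord_continuous : forall p, dom p -> {for p, continuous coord};
  param_continuous :
    forall x, (coord @` dom) x -> {for x, continuous param}
}.

Definition overlap (R : realType) (n : nat) (M : topologicalType)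
    (c d : chart R n M) : set (cspace R n) :=
  coord c @` (dom c `&` dom d).

Definition transition (R : realType) (n : nat) (M : topologicalType)
    (c d : chart R n M) : cspace R n -> cspace R n :=
  fun x => coord d (param c x).

Definition zcoord (R : realType) (n : nat) (k : 'I_n) (x : cspace R n) : R[i] :=
  x 0 (lshift n k) +i* x 0 (rshift n k).

Record complexManifold (R : realType) (n : nat) := ComplexManifold {
  carrier :> topologicalType;
  carrier_hausdorff : hausdorff_space carrier;
  carrier_second_countable : @second_countable carrier;
  atlas_index : Type;
  atlas : atlas_index -> chart R n carrier;
  atlas_cover : forall p, exists a, dom (atlas a) p;
  atlas_holomorphic : forall a b (k : 'I_n),
    holomorphic (overlap (atlas a) (atlas b))
      (fun x => zcoord k (transition (atlas a) (atlas b) x))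
}.

(* Tensor fields on M are families of local components, one for each chart of  *)
(* the atlas, obeying the transformation law on overlaps.                      *)

Section Manifold.
Variables (R : realType) (n : nat) (M : complexManifold R n).
Implicit Types (a b : atlas_index M).

Definition region a : set (cspace R n) := coord (atlas a) @` dom (atlas a).

Definition local (T : Type) (f : M -> T) a : cspace R n -> T :=
  fun x => f (param (atlas a) x).

Definition holomorphic_fun (f : M -> R[i]) :=
  forall a, holomorphic (region a) (local f a).

Definition smooth_fun (u : M -> R) :=
  forall a, smooth (region a) (local u a).

Record holomorphicPoisson := HolomorphicPoisson {
  poisson :> atlas_index M -> bivector R n;
  poisson_skew : forall a x, region a x -> (poisson a x)^T = - poisson a x;
  poisson_holomorphic : forall a i j,
    holomorphic (region a) (fun x => poisson a x i j);
  poisson_compat : forall a b x, overlap (atlas a) (atlas b) x ->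
    let tau := transition (atlas a) (atlas b) in
    let J : 'M[R[i]]_n :=
      \matrix_(i, k) cderive (ddz R i) (fun y => zcoord k (tau y)) x in
    poisson b (tau x) = J^T *m poisson a x *m J;
  poisson_schouten : forall a i j k x, region a x ->
    schouten (poisson a) (poisson a) i j k x = 0
}.

Record holomorphicVolume := HolomorphicVolume {
  volume :> atlas_index M -> form R n n;
  volume_holomorphic : forall a, holomorphic_form (region a) (volume a);
  volume_compat : forall a b x v, overlap (atlas a) (atlas b) x ->
    let tau := transition (atlas a) (atlas b) in
    volume a x v = volume b (tau x) (v *m map_mx (real_complex R) ('J tau x));
  volume_neq0 : forall a x, region a x -> exists v, volume a x v != 0
}.

(* A vector field is given by its components in each chart; the equation is    *)
(* an equality of forms on M, checked in each chart.                           *)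
Definition holomorphic_last_multiplier (w : holomorphicVolume)
    (Z : atlas_index M -> cspace R n -> ctangent R n) (alpha : M -> R[i]) :=
  holomorphic_fun alpha /\
  forall a x v, region a x ->
    del (scale (local alpha a) (interior (Z a) (w a))) x v = 0.

Definition real_last_multiplier (w : holomorphicVolume)
    (X : atlas_index M -> cspace R n -> cspace R n) (m : M -> R) :=
  smooth_fun m /\
  forall a x v, region a x ->
    dform (scale (fun y => (local m a y)%:C)
      (interior (fun y => map_mx (real_complex R) (X a y))
        (wedge (w a) (conj_form (w a))))) x v = 0.

Definition hamiltonian_field (P : holomorphicPoisson) (f : M -> R[i]) a :=
  hamiltonian (P a) (local f a).

Definition hamiltonian_fieldR (P : holomorphicPoisson) (u : M -> R) a :=
  real_hamiltonian (fun x => realPoissonR (P a x)) (local u a).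

Definition hamiltonian_fieldI (P : holomorphicPoisson) (u : M -> R) a :=
  real_hamiltonian (fun x => realPoissonI (P a x)) (local u a).

Definition sqnorm (f : M -> R[i]) : M -> R := fun p => normc (f p) ^+ 2.

End Manifold.

(* Main.v *)
Require Import Defs.
From mathcomp Require Import all_boot all_order all_algebra all_fingroup.
From mathcomp Require Import complex.
From mathcomp Require Import all_classical all_reals all_analysis.
From mathcomp Require Import ring.

(** Both conditions say that a divergence vanishes, and the two divergences are
    compared pointwise, in one chart.

    Write [h] for the coefficient of the volume form, [omega = h dz^1 /\ ... /\
    dz^n], and [Z^j = sum_i P^ij df/dz^i] for the components of [Z_f].  Then
    [del (f i_Z omega)] is, up to a constant determinant, the function
    [A = sum_j d(f h Z^j)/dz^j] ([del_contraction]).  On the real side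
    [omega /\ conj omega] is a constant multiple of [|h|^2 dx^1 /\ ... /\
    dx^2n] ([wedge_conjE]), so that [d (u i_X (omega /\ conj omega))] with
    [u = |f|^2] is the real divergence of [u |h|^2 X] ([dform_contraction]).
    Let [W_R] and [W_I] be these divergences for the two Hamiltonian fields of
    [u].

    Since [P = P_R + i P_I] has type (2,0), [W_R + i W_I] is the holomorphic
    divergence of [u |h|^2 sum_i P^ij du/dz^i].  Here [du/dz^i] is
    [conj f * df/dz^i], because [f] is holomorphic, and every antiholomorphic
    factor passes through [d/dz^j]; what is left is

      [W_R + i W_I = (conj f)^2 (conj h) A].

    As [W_R] and [W_I] are real, both vanish exactly when the right-hand side
    does, and [h] has no zero.  If [f x = 0] the factor [conj f] gives no
    information, but then [A x = h {f, f} = 0] by skew-symmetry of [P].  Hence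
    [A x = 0] if and only if [W_R x = W_I x = 0].

    The identification of forms with divergences rests on two determinant
    identities: an alternating form killed by every [ddzbar] is a multiple of
    [det] of its [dz]-coordinates ([form_n0E]), and the alternating sum of
    derivatives of minors defining [d] collapses by the adjugate identity
    ([sum_divergence]). *)

Set Implicit Arguments.
Unset Strict Implicit.
Unset Printing Implicit Defensive.

Import Order.TTheory GRing.Theory Num.Theory.
Import numFieldNormedType.Exports.

Local Open Scope classical_set_scope.
Local Open Scope ring_scope.
Local Open Scope complex_scope.

Local Notation Re := complex.Re.
Local Notation Im := complex.Im.

(** * Smooth functions on an open set *)

Lemma near_eq_differentiable (R : numFieldType) (V W : normedModType R)
    (f g : V -> W) (x : V) :
  (\near x, f x = g x) -> differentiable f x -> differentiable g x.
Proof.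
move=> fg df; have fx := nbhs_singleton fg.
have gE : g \o shift x = cst (g x) + 'd f x +o_ 0 id.
  apply/eqaddoP => e e0.
  have /eqaddoP/(_ e e0) dfo := diff_locally df.
  move: fg; rewrite (near_shift 0 x); apply: filter_app.
  move: dfo; apply: filterS => h /=.
  by rewrite -!fctE /= subr0 !fctE /= /cst fx => + <-.
have dE := diff_unique (diff_continuous df) gE.
by apply/diff_locallyP; rewrite dE; split=> //; exact: diff_continuous.
Qed.

Lemma open_near (T : topologicalType) (U : set T) (S : Type) (f g : T -> S) x :
  open U -> U x -> (forall y, U y -> f y = g y) -> \near x, f x = g x.
Proof.
by move=> oU Ux fg; apply: filterS (open_nbhs_nbhs (conj oU Ux)) => y /fg.
Qed.

Section Calculus.
Variables (R : realType) (n : nat).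
Implicit Types (U : set (cspace R n)) (u v : cspace R n -> R).
Implicit Types (g h : cspace R n -> R[i]) (x : cspace R n).

Lemma CkW k U u : Ck k.+1 U u -> Ck k U u.
Proof.
elim: k u => [|k IHk] u [du Du]; first by move=> x /du/differentiable_continuous.
by split=> // e; exact/IHk/Du.
Qed.

(** Smoothness on [U] says nothing of the values off [U], whereas [Ck] takes
    derivatives as total functions; identities between derivatives that hold on
    [U] only are transported by this lemma. *)
Lemma eq_Ck k U u v : open U -> (forall x, U x -> u x = v x) ->
  Ck k U u -> Ck k U v.
Proof.
move=> oU; elim: k u v => [|k IHk] u v uv.
  move=> cu x Ux; have uvx := open_near oU Ux uv.
  rewrite /prop_for /continuous_at -(uv x Ux).
  by apply: cvg_trans (cu x Ux); exact: (near_eq_cvg uvx).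
move=> [du Du]; split=> [x Ux|e].
  exact: near_eq_differentiable (open_near oU Ux uv) (du x Ux).
apply: IHk (Du e) => x Ux; exact: near_eq_derive (open_near oU Ux uv).
Qed.

Lemma CkD k U u v : open U -> Ck k U u -> Ck k U v -> Ck k U (u \+ v).
Proof.
move=> oU; elim: k u v => [|k IHk] u v.
  by move=> cu cv x Ux; apply: continuousD; [exact: cu|exact: cv].
move=> [du Du] [dv Dv]; split=> [x Ux|e].
  by apply: differentiableD; [exact: du|exact: dv].
apply: eq_Ck (IHk _ _ (Du e) (Dv e)) => // x Ux.
by rewrite /= -deriveD //; apply: diff_derivable; [exact: du|exact: dv].
Qed.

Lemma CkM k U u v : open U -> Ck k U u -> Ck k U v -> Ck k U (u \* v).
Proof.
move=> oU; elim: k u v => [|k IHk] u v.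
  by move=> cu cv x Ux; apply: continuousM; [exact: cu|exact: cv].
move=> uk vk; have [[du Du] [dv Dv]] := (uk, vk); split=> [x Ux|e].
  by apply: differentiableM; [exact: du|exact: dv].
have := CkD oU (IHk _ _ (CkW uk) (Dv e)) (IHk _ _ (CkW vk) (Du e)).
apply: eq_Ck => // x Ux.
by rewrite /= -deriveM //; apply: diff_derivable; [exact: du|exact: dv].
Qed.

Lemma smooth_sqnorm U g : open U -> csmooth U g ->
  smooth U (fun x => ComplexField.Normc.normc (g x) ^+ 2).
Proof.
move=> oU [sr si] k.
have := CkD oU (CkM oU (sr k) (sr k)) (CkM oU (si k) (si k)).
apply: eq_Ck => // x _; rewrite /=; case: (g x) => a b /=.
by rewrite sqr_sqrtr ?addr_ge0 ?sqr_ge0 // !expr2.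
Qed.

(** * Complexified first-order calculus *)

Definition cdifferentiable g x :=
  differentiable (fun y => Re (g y)) x /\ differentiable (fun y => Im (g y)) x.

Lemma csmooth_cdifferentiable U g x : csmooth U g -> U x -> cdifferentiable g x.
Proof. by move=> [sr si] Ux; split; [case: (sr 1%N)|case: (si 1%N)]; auto. Qed.

Lemma cdifferentiable_cst (c : R[i]) x : cdifferentiable (fun=> c) x.
Proof. by split; exact: differentiable_cst. Qed.

Lemma cdifferentiableD g h x : cdifferentiable g x -> cdifferentiable h x ->
  cdifferentiable (g \+ h) x.
Proof.
move=> [gr gi] [hr hi]; split.
  have := differentiableD gr hr; congr (differentiable _ x).
  by apply/funext => y; rewrite ?fctE /=; case: (g y) (h y) => [? ?] [? ?].
have := differentiableD gi hi; congr (differentiable _ x).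
by apply/funext => y; rewrite ?fctE /=; case: (g y) (h y) => [? ?] [? ?].
Qed.

Lemma cdifferentiableM g h x : cdifferentiable g x -> cdifferentiable h x ->
  cdifferentiable (g \* h) x.
Proof.
move=> [gr gi] [hr hi]; split.
  have := differentiableB (differentiableM gr hr) (differentiableM gi hi).
  congr (differentiable _ x).
  by apply/funext => y; rewrite ?fctE /=; case: (g y) (h y) => [? ?] [? ?].
have := differentiableD (differentiableM gr hi) (differentiableM gi hr).
congr (differentiable _ x).
by apply/funext => y /=; rewrite !fctE; case: (g y) (h y) => [? ?] [? ?] /=.
Qed.

Lemma cdifferentiable_sum (I : Type) (r : seq I) (G : I -> cspace R n -> R[i]) x :
  (forall i, cdifferentiable (G i) x) ->
  cdifferentiable (fun y => \sum_(i <- r) G i y) x.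
Proof.
move=> dG; elim: r => [|i r IHr].
  by under [X in cdifferentiable X]eq_fun do rewrite big_nil;
    exact: cdifferentiable_cst.
under [X in cdifferentiable X]eq_fun do rewrite big_cons.
exact: cdifferentiableD.
Qed.

Lemma cdifferentiable_conj g x : cdifferentiable g x ->
  cdifferentiable (fun y => conjc (g y)) x.
Proof.
move=> [gr gi]; split.
  by move: gr; congr (differentiable _ x); apply/funext => y /=; case: (g y).
move: (differentiableN gi); congr (differentiable _ x).
by apply/funext => y /=; rewrite fctE; case: (g y).
Qed.

Lemma cdifferentiable_real u x :
  differentiable u x -> cdifferentiable (fun y => (u y)%:C) x.
Proof. by move=> du; split=> //=; exact: differentiable_cst. Qed.

Lemma cdifferentiable_derive U g (w : ctangent R n) x :
  csmooth U g -> U x -> cdifferentiable (cderive w g) x.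
Proof.
move=> [sr si] Ux; apply: cdifferentiable_sum => a.
apply: (@cdifferentiableM (fun=> w 0 a)); first exact: cdifferentiable_cst.
by split; [have [_ /(_ (delta_mx 0 a))] := sr 2%N|
           have [_ /(_ (delta_mx 0 a))] := si 2%N] => -[+ _]; exact.
Qed.

Lemma eq_cpartial U g h a x : open U -> U x -> (forall y, U y -> g y = h y) ->
  cpartial a g x = cpartial a h x.
Proof.
move=> oU Ux gh; rewrite /cpartial /partial; congr (_ +i* _);
  by apply: near_eq_derive; apply: (open_near oU Ux) => y Uy; rewrite gh.
Qed.

Lemma cpartial_cst (c : R[i]) a x : cpartial a (fun=> c) x = 0.
Proof. by rewrite /cpartial /partial !derive_cst. Qed.

Lemma cpartialD g h a x : cdifferentiable g x -> cdifferentiable h x ->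
  cpartial a (g \+ h) x = cpartial a g x + cpartial a h x.
Proof.
move=> [gr gi] [hr hi]; set e : cspace R n := delta_mx 0 a.
have Dr := deriveD (@diff_derivable _ _ _ _ x e gr) (@diff_derivable _ _ _ _ x e hr).
have Di := deriveD (@diff_derivable _ _ _ _ x e gi) (@diff_derivable _ _ _ _ x e hi).
rewrite /cpartial /partial -/e; simpc; rewrite -Dr -Di.
congr (derive _ x e +i* derive _ x e); apply/funext => y; rewrite fctE /=;
  by case: (g y) (h y) => [? ?] [? ?].
Qed.

Lemma cpartialM g h a x : cdifferentiable g x -> cdifferentiable h x ->
  cpartial a (g \* h) x = cpartial a g x * h x + g x * cpartial a h x.
Proof.
move=> [gr gi] [hr hi]; set e : cspace R n := delta_mx 0 a.
have gr' := @diff_derivable _ _ _ _ x e gr.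
have gi' := @diff_derivable _ _ _ _ x e gi.
have hr' := @diff_derivable _ _ _ _ x e hr.
have hi' := @diff_derivable _ _ _ _ x e hi.
have Dr := deriveB (derivableM gr' hr') (derivableM gi' hi').
have Di := deriveD (derivableM gr' hi') (derivableM gi' hr').
rewrite (deriveM gr' hr') (deriveM gi' hi') in Dr.
rewrite (deriveM gr' hi') (deriveM gi' hr') in Di.
transitivity (derive (fun y => Re (g y * h y)) x e +i*
              derive (fun y => Im (g y * h y)) x e); first by [].
have -> : (fun y => Re (g y * h y)) = (fun y => Re (g y)) * (fun y => Re (h y))
    - (fun y => Im (g y)) * (fun y => Im (h y)).
  by apply/funext => y; rewrite !fctE; case: (g y) (h y) => [? ?] [? ?].
have -> : (fun y => Im (g y * h y)) = (fun y => Re (g y)) * (fun y => Im (h y))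
    + (fun y => Im (g y)) * (fun y => Re (h y)).
  by apply/funext => y; rewrite !fctE; case: (g y) (h y) => [? ?] [? ?].
rewrite Dr Di /cpartial /partial -/e.
move: (derive _ x e) (derive _ x e) (derive _ x e) (derive _ x e) => a1 a2 a3 a4.
case: (g x) (h x) => [p q] [r s] /=; simpc.
by rewrite /GRing.scale /=; congr (_ +i* _); ring.
Qed.

Lemma cpartial_sum (I : Type) (r : seq I) (G : I -> cspace R n -> R[i]) a x :
  (forall i, cdifferentiable (G i) x) ->
  cpartial a (fun y => \sum_(i <- r) G i y) x = \sum_(i <- r) cpartial a (G i) x.
Proof.
move=> dG; elim: r => [|i r IHr].
  by under [X in cpartial a X]eq_fun do rewrite big_nil;
    rewrite cpartial_cst big_nil.
under [X in cpartial a X]eq_fun do rewrite big_cons.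
rewrite big_cons -IHr; apply: cpartialD => //.
exact: cdifferentiable_sum.
Qed.

Lemma cpartialZ (c : R[i]) g a x : cdifferentiable g x ->
  cpartial a (fun y => c * g y) x = c * cpartial a g x.
Proof.
move=> dg; rewrite (cpartialM a (cdifferentiable_cst c x) dg).
by rewrite cpartial_cst mul0r add0r.
Qed.

Lemma cpartial_conj g a x : cdifferentiable g x ->
  cpartial a (fun y => conjc (g y)) x = conjc (cpartial a g x).
Proof.
move=> [gr gi]; rewrite /cpartial /partial /=; congr (_ +i* _).
  by congr ('D__ _ x); apply/funext => y /=; case: (g y).
rewrite -deriveN; last exact: diff_derivable.
by congr ('D__ _ x); apply/funext => y /=; rewrite fctE; case: (g y).
Qed.

Lemma cpartial_real u a x :
  cpartial a (fun y => (u y)%:C) x = (partial a u x)%:C.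
Proof. by rewrite /cpartial /partial /= derive_cst. Qed.

Lemma eq_cderive U g h w x : open U -> U x -> (forall y, U y -> g y = h y) ->
  cderive w g x = cderive w h x.
Proof.
by move=> oU Ux gh; apply: eq_bigr => a _; rewrite (eq_cpartial a oU Ux gh).
Qed.

Lemma cderiveM g h w x : cdifferentiable g x -> cdifferentiable h x ->
  cderive w (g \* h) x = cderive w g x * h x + g x * cderive w h x.
Proof.
move=> dg dh; rewrite /cderive mulr_suml mulr_sumr -big_split /=.
by apply: eq_bigr => a _; rewrite cpartialM //; ring.
Qed.

Lemma cderive_sum (I : Type) (r : seq I) (G : I -> cspace R n -> R[i]) w x :
  (forall i, cdifferentiable (G i) x) ->
  cderive w (fun y => \sum_(i <- r) G i y) x = \sum_(i <- r) cderive w (G i) x.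
Proof.
move=> dG; rewrite /cderive exchange_big; apply: eq_bigr => a _ /=.
by rewrite cpartial_sum // mulr_sumr.
Qed.

Lemma cderiveZ (c : R[i]) g w x : cdifferentiable g x ->
  cderive w (fun y => c * g y) x = c * cderive w g x.
Proof.
move=> dg; rewrite /cderive mulr_sumr; apply: eq_bigr => a _.
by rewrite cpartialZ //; ring.
Qed.

Lemma cderive_conj g w x : cdifferentiable g x ->
  cderive w (fun y => conjc (g y)) x = conjc (cderive (map_mx conjc w) g x).
Proof.
move=> dg; rewrite /cderive rmorph_sum; apply: eq_bigr => a _ /=.
by rewrite rmorphM /= mxE conjcK cpartial_conj.
Qed.

Lemma cderive_suml (I : Type) (r : seq I) (c : I -> R[i])
    (w : I -> ctangent R n) g x :
  cderive (\sum_(i <- r) c i *: w i) g x = \sum_(i <- r) c i * cderive (w i) g x.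
Proof.
rewrite /cderive.
under eq_bigr do rewrite summxE mulr_suml.
rewrite exchange_big /=; apply: eq_bigr => i _; rewrite mulr_sumr.
by apply: eq_bigr => a _; rewrite mxE mulrA.
Qed.

End Calculus.

(** * Determinants *)

Section Determinants.
Variable K : comNzRingType.

Lemma col_mx_row0 k m (z : 'rV[K]_m) (A : 'M[K]_(k, m)) j :
  (col_mx z A : 'M[K]_(k.+1, m)) 0 j = z 0 j.
Proof.
transitivity (col_mx z A (lshift k 0) j); last exact: col_mxEu.
by congr (col_mx z A _ j); exact/val_inj.
Qed.

Lemma col_mx_lift0 k m (z : 'rV[K]_m) (A : 'M[K]_(k, m)) i j :
  (col_mx z A : 'M[K]_(k.+1, m)) (lift 0 i) j = A i j.
Proof.
transitivity (col_mx z A (rshift 1 i) j); last exact: col_mxEd.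
by congr (col_mx z A _ j); exact/val_inj.
Qed.

Lemma cofactor_col_mx k (z : 'rV[K]_k.+1) (A : 'M[K]_(k, k.+1)) j :
  cofactor (col_mx z A : 'M[K]_k.+1) 0 j = (-1) ^+ j * \det (col' j A).
Proof.
rewrite /cofactor add0n; congr (_ * \det _).
by apply/matrixP => p q; rewrite 2!mxE col_mx_lift0 mxE.
Qed.

Lemma det_col_mxZ k (c : K) (z : 'rV[K]_k.+1) (A : 'M[K]_(k, k.+1)) :
  \det (col_mx (c *: z) A : 'M[K]_k.+1) = c * \det (col_mx z A : 'M[K]_k.+1).
Proof.
rewrite !(expand_det_row _ 0) mulr_sumr; apply: eq_bigr => j _.
by rewrite !col_mx_row0 !cofactor_col_mx mxE -mulrA.
Qed.

(** Unordered Laplace expansion along the first half of the columns: after the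
    Leibniz formula for both minors, the sum over [s] is the determinant of
    [row_mx A B] with its two column blocks permuted, whose two signs cancel
    those of the minors. *)
Lemma det_shuffle n (A B : 'M[K]_(n + n, n)) :
  \sum_(s : 'S_(n + n)) (-1) ^+ s *
    (\det (usubmx (row_perm s A)) * \det (dsubmx (row_perm s B))) =
  (n`! * n`!)%:R * \det (row_mx A B).
Proof.
pose T (p q : 'S_n) : 'M[K]_(n + n) := row_mx (col_perm p A) (col_perm q B).
have detT (p q : 'S_n) : \det (T p q) = (-1) ^+ p * (-1) ^+ q * \det (row_mx A B).
  have -> : T p q = row_mx A B *m block_mx (perm_mx p^-1) 0 0 (perm_mx q^-1).
    by rewrite mul_row_block !mulmx0 add0r addr0 /T !col_permE.
  by rewrite det_mulmx det_ublock !det_perm !odd_permV mulrC.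
have sumE (p q : 'S_n) : \sum_(s : 'S_(n + n)) (-1) ^+ s *
    ((\prod_i A (s (lshift n i)) (p i)) * \prod_i B (s (rshift n i)) (q i)) =
    \det (T p q).
  rewrite -det_tr; apply: eq_bigr => s _; congr (_ * _).
  rewrite big_split_ord /=; congr (_ * _); apply: eq_bigr => i _; rewrite mxE.
    by rewrite row_mxEl mxE.
  by rewrite row_mxEr mxE.
transitivity (\sum_(p : 'S_n) \sum_(q : 'S_n) (-1) ^+ p * (-1) ^+ q * \det (T p q)).
  under [RHS]eq_bigr do under eq_bigr do rewrite -sumE mulr_sumr.
  under [RHS]eq_bigr do rewrite exchange_big /=.
  rewrite [RHS]exchange_big /=; apply: eq_bigr => s _.
  rewrite /determinant mulr_suml mulr_sumr; apply: eq_bigr => p _.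
  rewrite mulr_sumr mulr_sumr; apply: eq_bigr => q _.
  under eq_bigr do rewrite !mxE; under [X in _ * (_ * (_ * X))]eq_bigr do rewrite !mxE.
  by rewrite [RHS]mulrCA; congr (_ * _); exact: mulrACA.
transitivity (\sum_(p : 'S_n) \sum_(q : 'S_n) \det (row_mx A B)).
  apply: eq_bigr => p _; apply: eq_bigr => q _; rewrite detT.
  by rewrite mulrA mulrACA -!expr2 !sqrr_sign !mul1r.
by rewrite !sumr_const !card_Sn mulr_natl mulrnA.
Qed.

End Determinants.

(** * The frame of coordinate and conjugate vector fields *)

Section Forms.
Variables (R : realType) (n : nat).
Local Notation C := R[i].
Local Notation V := (ctangent R n).

Let mulii : 'i * 'i = -1 :> C.
Proof. by rewrite -expr2 sqr_i. Qed.

Let add_halves : 2%:R^-1 + 2%:R^-1 = 1 :> C.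
Proof. by field. Qed.

Let conjc_i : conjc ('i : C) = - 'i.
Proof. by apply/eqP; rewrite eq_complex /= oppr0 !eqxx. Qed.

(** The coordinate forms [dz], acting on the right of the matrices whose rows are
    the arguments of a form. *)
Definition dz_mx : 'M[C]_(n + n, n) := col_mx 1%:M 'i%:M.

Lemma mul_dz_mx m (v : 'M[C]_(m, n + n)) i j : (v *m dz_mx) i j = dz j (row i v).
Proof.
by rewrite -{1}[v]hsubmxK mul_row_col mulmx1 mul_mx_scalar /dz !mxE.
Qed.

Definition ddz_mx : 'M[C]_(n, n + n) := \matrix_(j, a) ddz R j 0 a.

Lemma dz_ddz (j k : 'I_n) : dz j (ddz R k) = (j == k)%:R.
Proof.
rewrite /dz /ddz !mxE ?eq_lrshift ?eq_rlshift ?eqxx ?(inj_eq (@lshift_inj _ _))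
  ?(inj_eq (@rshift_inj _ _)) /=.
by case: (j == k) => /=; ring: mulii add_halves.
Qed.

Lemma dz_ddzbar (j k : 'I_n) : dz j (ddzbar R k) = 0.
Proof.
rewrite /dz /ddzbar !mxE ?eq_lrshift ?eq_rlshift ?eqxx ?(inj_eq (@lshift_inj _ _))
  ?(inj_eq (@rshift_inj _ _)) /=.
by case: (j == k) => /=; ring: mulii.
Qed.

Lemma dzbar_ddzbar (j k : 'I_n) : dzbar j (ddzbar R k) = (j == k)%:R.
Proof.
rewrite /dzbar /ddzbar !mxE ?eq_lrshift ?eq_rlshift ?eqxx
  ?(inj_eq (@lshift_inj _ _)) ?(inj_eq (@rshift_inj _ _)) /=.
by case: (j == k) => /=; ring: mulii add_halves.
Qed.

Lemma part01_ddzbar j : part01 (ddzbar R j) = ddzbar R j :> V.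
Proof.
rewrite /part01 (bigD1 j) //= dzbar_ddzbar eqxx scale1r big1 ?addr0 // => k kj.
by rewrite dzbar_ddzbar (negPf kj) scale0r.
Qed.

Lemma part01_ddz j : part01 (ddz R j) = 0 :> V.
Proof.
apply: (addrI (part10 (ddz R j))); rewrite -part10D01 addr0.
rewrite /part10 (bigD1 j) //= dz_ddz eqxx scale1r big1 ?addr0 // => k kj.
by rewrite dz_ddz (negPf kj) scale0r.
Qed.

Lemma ddz_mxK : ddz_mx *m dz_mx = 1%:M.
Proof.
apply/matrixP => i j; rewrite mul_dz_mx !mxE.
have -> : row i ddz_mx = ddz R i by apply/rowP => a; rewrite !mxE.
by rewrite dz_ddz eq_sym.
Qed.

Lemma conj_ddz j : map_mx conjc (ddz R j) = ddzbar R j :> ctangent R n.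
Proof.
have conjE (p q : nat) : conjc (2%:R^-1 * (p%:R - 'i * q%:R) : C) =
    2%:R^-1 * (p%:R + 'i * q%:R).
  rewrite rmorphM rmorphB rmorphM fmorphV !rmorph_nat.
  set c := (X in _ * (_ - X * _)).
  by have -> : c = - 'i; [exact: conjc_i|rewrite mulNr opprK].
by apply/rowP => a; rewrite /ddz /ddzbar !mxE; exact: conjE.
Qed.

Definition dzbar_mx : 'M[C]_(n + n, n) := map_mx conjc dz_mx.

(** The covectors [dz j] and [dzbar j] together form a basis, dual to the [ddz]
    and [ddzbar]. *)
Lemma det_dz_dzbar_neq0 : \det (row_mx dz_mx dzbar_mx) != 0.
Proof.
have dzbar_mxE : dzbar_mx = col_mx 1%:M (- 'i)%:M.
  have conj1 : conjc (1 : C) = 1 by rewrite conjc1.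
  rewrite /dzbar_mx map_col_mx !map_scalar_mx.
  by congr (col_mx _%:M _%:M); [exact: conj1|exact: conjc_i].
apply/negP => /eqP d0.
(* the left inverse has the [ddz] and [ddzbar] as its rows *)
have : \det (block_mx (2%:R^-1)%:M (- ('i / 2%:R))%:M (2%:R^-1)%:M ('i / 2%:R)%:M
    *m row_mx dz_mx dzbar_mx) = 1.
  rewrite /dz_mx dzbar_mxE -block_mxEh mulmx_block.
  rewrite !mulmx1 -!scalar_mxM -!raddfD /=.
  set a := _ + _; have -> : a = 1 by rewrite /a; ring: mulii add_halves.
  set b := _ + _; have -> : b = 0 by rewrite /b; ring: mulii add_halves.
  set c := _ + _; have -> : c = 0 by rewrite /c; ring: mulii add_halves.
  set d := _ + _; have -> : d = 1 by rewrite /d; ring: mulii add_halves.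
  by rewrite raddf0 -scalar_mx_block det1.
by rewrite det_mulmx d0 mulr0 => /eqP; rewrite eq_sym oner_eq0.
Qed.

Lemma PoissonRDI_entry (Q : 'M[C]_n) a b :
  (realPoissonR Q a b)%:C + 'i * (realPoissonI Q a b)%:C =
  \sum_j \sum_i ddz R i 0 a * Q i j * ddz R j 0 b.
Proof.
have := PoissonRDI Q; set B := \matrix_(j, a) ddz R j 0 a.
move: (realPoissonR Q) (realPoissonI Q) => S T /matrixP/(_ a b) ST.
transitivity ((map_mx (real_complex R) S + 'i *: map_mx (real_complex R) T) a b).
  by rewrite !mxE.
rewrite -ST mxE; apply: eq_bigr => j _.
have -> : B j b = ddz R j 0 b by rewrite mxE.
rewrite mxE mulr_suml; apply: eq_bigr => i _.
by have -> : B^T a i = ddz R i 0 a by rewrite 2!mxE.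
Qed.

(** * Alternating forms *)

Definition set_row k (v : 'M[C]_(k, n + n)) (i : 'I_k) (w : V) :
    'M[C]_(k, n + n) :=
  \matrix_(i', a) if i' == i then w 0 a else v i' a.

Lemma row_set_row k (v : 'M[C]_(k, n + n)) i w : row i (set_row v i w) = w.
Proof. by apply/rowP => a; rewrite !mxE eqxx. Qed.

Lemma row_set_row_neq k (v : 'M[C]_(k, n + n)) i j w :
  j != i -> row j (set_row v i w) = row j v.
Proof. by move=> ji; apply/rowP => a; rewrite !mxE (negPf ji). Qed.

Lemma row'_set_row k (v : 'M[C]_(k, n + n)) i w :
  row' i (set_row v i w) = row' i v.
Proof. by apply/matrixP => j a; rewrite !mxE eq_sym (negPf (neq_lift _ _)). Qed.

Lemma set_row_id k (v : 'M[C]_(k, n + n)) i : set_row v i (row i v) = v.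
Proof. by apply/matrixP => j a; rewrite !mxE; case: eqP => // ->. Qed.

Section OneForm.
Variables (k : nat) (eta : 'M[C]_(k, n + n) -> C).
Hypothesis alt_eta : Defs.alternating eta.

Lemma alternating_set_rowP v i (c : C) (a b : V) :
  eta (set_row v i (c *: a + b)) = c * eta (set_row v i a) + eta (set_row v i b).
Proof. by apply: (alt_eta.1 i); rewrite ?row_set_row ?row'_set_row. Qed.

Lemma alternating_set_row0 v i : eta (set_row v i 0) = 0.
Proof.
have := alternating_set_rowP v i 1 0 0; rewrite scaler0 addr0 mul1r.
by move/eqP; rewrite -subr_eq0 opprD addNKr oppr_eq0 => /eqP.
Qed.

Lemma alternating_set_row_sum (I : Type) (r : seq I) (c : I -> C) (w : I -> V) v i :
  eta (set_row v i (\sum_(t <- r) c t *: w t)) =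
  \sum_(t <- r) c t * eta (set_row v i (w t)).
Proof.
elim: r => [|t r IHr]; first by rewrite !big_nil alternating_set_row0.
by rewrite !big_cons alternating_set_rowP IHr.
Qed.

Lemma alternating_xrow v i j : i != j -> eta (xrow i j v) = - eta v.
Proof.
move=> ij; have ji : j != i by rewrite eq_sym.
pose F (a b : V) := eta (set_row (set_row v i a) j b).
have F0 a : F a a = 0.
  apply: (alt_eta.2 _ i j) => //.
  by rewrite row_set_row row_set_row_neq // row_set_row.
have FDr a b b' : F a (b + b') = F a b + F a b'.
  by rewrite -[b in LHS]scale1r /F alternating_set_rowP mul1r.
have FDl a a' b : F (a + a') b = F a b + F a' b.
  have sC (c : V) : set_row (set_row v i c) j b = set_row (set_row v j b) i c.
    apply/matrixP => k' t; rewrite !mxE.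
    by case: (eqVneq k' j) => // ->; rewrite (negPf ji).
  by rewrite -[a in LHS]scale1r /F !sC alternating_set_rowP mul1r.
have /eqP := F0 (row i v + row j v).
rewrite FDl !FDr !F0 add0r addr0 addr_eq0 => /eqP Fswap.
have -> : v = set_row (set_row v i (row i v)) j (row j v) by rewrite !set_row_id.
rewrite -/(F _ _) Fswap opprK; congr eta; apply/matrixP => k' t; rewrite !mxE.
case: tpermP => [->|->|/eqP ki /eqP kj]; rewrite ?eqxx ?(negPf ij) ?(negPf ji) //.
by rewrite (negPf ki) (negPf kj).
Qed.

Lemma alternating_row_perm (s : 'S_k) v :
  eta (row_perm s v) = (-1) ^+ s * eta v.
Proof.
have [ts -> dts] := prod_tpermP s; elim: ts dts => [|[i j] ts IHts] /=.
  by rewrite big_nil odd_perm1 mul1r row_perm1.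
case/andP=> /= ij dts; rewrite big_cons /= odd_permM odd_tperm ij.
rewrite row_permM -/(xrow i j _) alternating_xrow // IHts //.
by rewrite signr_addb expr1 !mulN1r mulNr.
Qed.

(** Multilinearity expands each argument over a spanning family: rows outside
    the family are replaced one at a time, last one first. *)
Lemma alternating_eq0 (I : finType) (e : I -> V) (c : V -> I -> C) :
  (forall w, w = \sum_t c w t *: e t) ->
  (forall phi : 'I_k -> I, eta (\matrix_(i, a) e (phi i) 0 a) = 0) ->
  forall v, eta v = 0.
Proof.
move=> span eta0.
suff main r : (r <= k)%N -> forall v,
    (forall i : 'I_k, (r <= i)%N -> exists t, row i v = e t) -> eta v = 0.
  by move=> v; apply: (main k) => // i; rewrite leqNgt ltn_ord.
elim: r => [|r IHr] rk v vE.
  have /choice [phi phiE] : forall i, exists t, row i v = e t by move=> i; exact: vE.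
  rewrite -(eta0 phi); congr eta; apply/matrixP => i a.
  by rewrite !mxE -phiE mxE.
pose i := Ordinal rk; rewrite -[v](set_row_id _ i) [row i v]span.
rewrite alternating_set_row_sum big1 // => t _.
rewrite [eta _]IHr ?mulr0 ?(ltnW rk) // => j rj.
have [->|ji] := eqVneq j i; first by exists t; rewrite row_set_row.
rewrite row_set_row_neq //; apply: vE; rewrite ltn_neqAle rj andbT.
by apply: contraNneq ji => rj'; apply/eqP/val_inj.
Qed.

End OneForm.

Lemma alternating_det (c : C) :
  Defs.alternating (fun v : 'M[C]_(n, n + n) => c * \det (v *m dz_mx)).
Proof.
have row'M (i : 'I_n) (A B : 'M[C]_(n, n + n)) :
    row' i A = row' i B -> row' i (A *m dz_mx) = row' i (B *m dz_mx).
  move=> AB; apply/matrixP => p q; rewrite !mxE; apply: eq_bigr => l _.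
  by have /matrixP/(_ p l) := AB; rewrite !mxE => ->.
split=> [i v a b d rv ra rb|v i j ij vij].
  rewrite (@determinant_multilinear _ _ _ (a *m dz_mx) (b *m dz_mx) i d 1).
  - by ring.
  - by rewrite !row_mul rv mulmxDl -scalemxAl scale1r.
  - exact: row'M.
  - exact: row'M.
rewrite (determinant_alternate ij) ?mulr0 // => l.
by rewrite !mul_dz_mx vij.
Qed.

Lemma alternatingB k (eta theta : 'M[C]_(k, n + n) -> C) :
  Defs.alternating eta -> Defs.alternating theta ->
  Defs.alternating (fun v => eta v - theta v).
Proof.
move=> [le ae] [lt at_]; split=> [i v a b c rv ra rb|v i j ij vij].
  by rewrite (le i v a b c) // (lt i v a b c) //; ring.
by rewrite (ae v i j) // (at_ v i j) // subr0.
Qed.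

(** An [(n, 0)]-form is a multiple of [dz^1 /\ ... /\ dz^n], because both sides
    agree on every choice of rows among the [ddz] and [ddzbar]. *)
Lemma form_n0E (eta : 'M[C]_(n, n + n) -> C) : Defs.alternating eta ->
  (forall v (i : 'I_n) j, row i v = ddzbar R j -> eta v = 0) ->
  forall v, eta v = eta ddz_mx * \det (v *m dz_mx).
Proof.
move=> alt_eta eta0 v; apply/eqP; rewrite -subr_eq0; apply/eqP; move: v.
set delta := fun v => eta v - eta ddz_mx * \det (v *m dz_mx).
have alt_delta : Defs.alternating delta.
  exact/alternatingB/alternating_det.
pose e (t : 'I_n + 'I_n) : V := match t with inl j => ddz R j | inr j => ddzbar R j end.
pose c (w : V) (t : 'I_n + 'I_n) := match t with inl j => dz j w | inr j => dzbar j w end.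
apply: (@alternating_eq0 _ delta alt_delta _ e c) => [w|phi].
  by rewrite big_sumType /= -part10D01.
set v := \matrix_(_, _) _.
have rowv i : row i v = e (phi i) by apply/rowP => a; rewrite !mxE.
have [[i inri]|inlP] := pselect (exists i, if phi i is inr _ then true else false).
  move: (rowv i) inri; case: (phi i) => // j rvi _; rewrite /delta (eta0 v i j) //.
  rewrite (expand_det_row _ i) big1 ?mulr0 ?subr0 // => l _.
  by rewrite mul_dz_mx rvi /= dz_ddzbar mul0r.
have /choice [f phiE] : forall i, exists j, phi i = inl j.
  move=> i; case phiE : (phi i) => [j|j]; first by exists j.
  by case: inlP; exists i; rewrite phiE.
have [injf|] := boolP (injectiveb f).
  have -> : v = row_perm (perm (injectiveP _ injf)) ddz_mx.
    by apply/matrixP => i a; rewrite !mxE permE phiE /= !mxE.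
  rewrite (alternating_row_perm alt_delta) /delta ddz_mxK det1 mulr1 subrr.
  by rewrite mulr0.
case/injectivePn => i [j ij fij]; apply: (alt_delta.2 _ i j ij).
by rewrite !rowv !phiE fij.
Qed.

(** The sum over all permutations of [2n] arguments is an unordered Laplace
    expansion, whose [n! n!] repetitions the normalization of [wedge] removes. *)
Lemma wedge_conjE (w : Defs.form R n n) x (h : C) :
  (forall v, w x v = h * \det (v *m dz_mx)) -> forall v,
  wedge w (conj_form w) x v =
  h * conjc h * \det (row_mx dz_mx dzbar_mx) * \det v.
Proof.
move=> wE v; rewrite /wedge /conj_form.
have dzbarE (v' : 'M[C]_(n, n + n)) :
    conjc (w x (map_mx conjc v')) = conjc h * \det (v' *m dzbar_mx).
  rewrite wE rmorphM /= -det_map_mx map_mxM; congr (_ * \det (_ *m _)).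
  by apply/matrixP => i j; rewrite !mxE; exact: conjcK.
have termE (s : 'S_(n + n)) : w x (usubmx (row_perm s v)) *
    conjc (w x (map_mx conjc (dsubmx (row_perm s v)))) = h * conjc h *
    (\det (usubmx (row_perm s (v *m dz_mx))) *
     \det (dsubmx (row_perm s (v *m dzbar_mx)))).
  by rewrite wE dzbarE mulrACA !mul_usub_mx !mul_dsub_mx !row_permE !mulmxA.
under eq_bigr do rewrite termE mulrCA.
rewrite -mulr_sumr det_shuffle mulrCA mulKf.
  by rewrite -mul_mx_row det_mulmx; ring.
by rewrite pnatr_eq0 -lt0n muln_gt0 fact_gt0.
Qed.

End Forms.

(** * Divergences *)

Section Divergence.
Variables (R : realType) (n : nat).
Local Notation C := R[i].
Implicit Types x : cspace R n.

(** In the exterior derivative of a contracted top form, expand every minor along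
    its first row: the coefficient of the derivative of [G j] along [e l] is
    [sum_i N i l * cofactor N i j], which is [det N] for [l = j] and [0]
    otherwise. *)
Lemma sum_divergence k (N : 'M[C]_k.+1) (G : 'I_k.+1 -> cspace R n -> C)
    (e : 'I_k.+1 -> ctangent R n) x :
  (forall j, cdifferentiable (G j) x) ->
  \sum_(i < k.+1) (-1) ^+ i * cderive (\sum_j N i j *: e j)
    (fun y => \det (col_mx (\row_j G j y) (row' i N) : 'M[C]_k.+1)) x =
  \det N * \sum_j cderive (e j) (G j) x.
Proof.
move=> dG.
have detE i y : \det (col_mx (\row_j G j y) (row' i N) : 'M[C]_k.+1) =
    \sum_j ((-1) ^+ i * cofactor N i j) * G j y.
  rewrite (expand_det_row _ 0); apply: eq_bigr => j _.
  rewrite col_mx_row0 mxE mulrC cofactor_col_mx /cofactor.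
  rewrite exprD !mulrA -expr2 sqrr_sign mul1r; congr (_ * \det _ * _).
  by apply/matrixP => p q; rewrite !mxE.
transitivity (\sum_i \sum_j \sum_l N i l * cofactor N i j * cderive (e l) (G j) x).
  apply: eq_bigr => i _; under [X in cderive _ X _]eq_fun do rewrite detE.
  rewrite cderive_sum => [|j]; last first.
    by apply: (@cdifferentiableM _ _ (fun=> _)) => //; exact: cdifferentiable_cst.
  rewrite mulr_sumr; apply: eq_bigr => j _.
  rewrite cderiveZ // !mulrA -expr2 sqrr_sign mul1r cderive_suml mulr_sumr.
  by apply: eq_bigr => l _; rewrite mulrA [cofactor _ _ _ * _]mulrC.
transitivity (\sum_j \sum_l (\adj N *m N) j l * cderive (e l) (G j) x).
  rewrite exchange_big /=; apply: eq_bigr => j _.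
  rewrite exchange_big /=; apply: eq_bigr => l _.
  rewrite mxE mulr_suml; apply: eq_bigr => i _.
  by rewrite mxE [cofactor _ _ _ * _]mulrC.
rewrite mulr_sumr; apply: eq_bigr => j _; rewrite mul_adj_mx (bigD1 j) //= big1.
  by rewrite mxE eqxx addr0.
by move=> l lj; rewrite mxE eq_sym (negPf lj) mul0r.
Qed.

End Divergence.

(** * The two conditions in a chart *)

Lemma eq_real_imag (R : realType) (a b : R) : a%:C + 'i * b%:C = 0 -> a = 0 /\ b = 0.
Proof. by simpc => /eqP; rewrite eq_complex /= => /andP [/eqP -> /eqP ->]. Qed.

Section Chart.
Variables (R : realType) (n' : nat).
Local Notation n := n'.+1.
Local Notation C := R[i].

Variables (U : set (cspace R n)) (P : bivector R n) (w : Defs.form R n n).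
Variables (f : cspace R n -> C) (u : cspace R n -> R).
Hypothesis openU : open U.
Hypothesis skewP : forall x, U x -> (P x)^T = - P x.
Hypothesis holP : forall i j, holomorphic U (fun x => P x i j).
Hypothesis holw : holomorphic_form U w.
Hypothesis w_neq0 : forall x, U x -> exists v, w x v != 0.
Hypothesis holf : holomorphic U f.
Hypothesis smooth_u : smooth U u.
Hypothesis uE : forall x, (u x)%:C = f x * conjc (f x).

Let h y := w y (ddz_mx R n).

Let wE y v : U y -> w y v = h y * \det (v *m dz_mx R n).
Proof.
case: holw => -[altw _] w0 _ Uy.
by apply: form_n0E (altw y Uy) _ v => v' i j; exact: w0.
Qed.

Let smooth_h : csmooth U h.
Proof. by case: holw => -[_ sw] _ _; exact: sw. Qed.

(* The only term of [delbar w] on [ddzbar j, ddz 1, ..., ddz n] that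
   differentiates along a (0,1)-vector is the first. *)
Let dbar_h j x : U x -> cderive (ddzbar R j) h x = 0.
Proof.
case: holw => _ _ dbar0 Ux.
have := dbar0 x (col_mx (ddzbar R j) (ddz_mx R n)) Ux.
rewrite /delbar big_ord_recl big1 => [|i _].
  rewrite addr0 expr0 mul1r.
  have -> : row 0 (col_mx (ddzbar R j) (ddz_mx R n)) = ddzbar R j.
    by apply/rowP => a; rewrite mxE col_mx_row0.
  rewrite part01_ddzbar; congr (cderive _ _ x = 0); apply/funext => y.
  congr (w y); apply/matrixP => p q.
  by rewrite mxE col_mx_lift0.
have -> : row (lift 0 i) (col_mx (ddzbar R j) (ddz_mx R n)) = ddz R i.
  by apply/rowP => a; rewrite mxE col_mx_lift0 mxE.
rewrite part01_ddz /cderive big1 ?mulr0 // => a _.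
by rewrite mxE mul0r.
Qed.

Let h_neq0 x : U x -> h x != 0.
Proof.
move=> Ux; have [v] := w_neq0 Ux.
by rewrite wE //; apply: contraNneq => ->; rewrite mul0r.
Qed.

(** The [(1, 0)] components of the Hamiltonian field of [f]. *)
Let Z j y := \sum_i P y i j * cderive (ddz R i) f y.

Let hamiltonian_dz y : hamiltonian P f y *m dz_mx R n = \row_j Z j y.
Proof.
apply/rowP => j; rewrite [RHS]mxE /hamiltonian mulmx_suml summxE.
apply: eq_bigr => i _; rewrite mulmx_suml summxE (bigD1 j) //= big1 => [|k kj].
  by rewrite addr0 -scalemxAl mxE mul_dz_mx row_id dz_ddz eqxx mulr1.
by rewrite -scalemxAl mxE mul_dz_mx row_id dz_ddz eq_sym (negPf kj) mulr0.
Qed.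

(** The coefficient of [del (f i_Z omega)] on [dz^1 /\ ... /\ dz^n]. *)
Let A x := \sum_j cderive (ddz R j) (fun y => f y * h y * Z j y) x.

Let diff_f x : U x -> cdifferentiable f x.
Proof. by move=> Ux; exact: csmooth_cdifferentiable holf.1 Ux. Qed.

Let diff_h x : U x -> cdifferentiable h x.
Proof. by move=> Ux; exact: csmooth_cdifferentiable smooth_h Ux. Qed.

Let diff_P x i j : U x -> cdifferentiable (fun y => P y i j) x.
Proof. by move=> Ux; exact: csmooth_cdifferentiable (holP i j).1 Ux. Qed.

Let diff_u x : U x -> cdifferentiable (fun y => (u y)%:C) x.
Proof.
by move=> Ux; apply: cdifferentiable_real; case: (smooth_u 1%N) => + _; exact.
Qed.

Let diff_Z x j : U x -> cdifferentiable (Z j) x.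
Proof.
move=> Ux; apply: cdifferentiable_sum => i.
apply: cdifferentiableM; first exact: diff_P.
exact: cdifferentiable_derive holf.1 Ux.
Qed.

Lemma del_contraction x (v : 'M[C]_(n, n + n)) : U x ->
  del (scale f (Defs.interior (hamiltonian P f) w)) x v =
  \det (v *m dz_mx R n) * A x.
Proof.
move=> Ux; rewrite -sum_divergence => [|j]; last first.
  by do 2?apply: cdifferentiableM; auto.
apply: eq_bigr => i _; congr (_ * _).
have -> : part10 (row i v) = \sum_j (v *m dz_mx R n) i j *: ddz R j.
  by apply: eq_bigr => j _; rewrite mul_dz_mx.
apply: (eq_cderive _ openU Ux) => y Uy; rewrite /scale /= wE //.
have -> : \row_j (f y * h y * Z j y) = (f y * h y) *: (hamiltonian P f y *m dz_mx R n).
  by rewrite hamiltonian_dz; apply/rowP => j; rewrite !mxE.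
rewrite det_col_mxZ mulrA; congr (_ * \det _).
apply: (etrans (mul_col_mx (hamiltonian P f y) (row' i v) (dz_mx R n))); congr col_mx.
by apply/matrixP => p q; rewrite !mxE; apply: eq_bigr => l _; rewrite !mxE.
Qed.

(** [d (u i_X (omega /\ conj omega))], as the divergence of [u |h|^2 X]. *)
Let W (X : cspace R n -> cspace R n) x :=
  \sum_b cpartial b (fun y => (u y)%:C * (h y * conjc (h y)) * (X y 0 b)%:C) x.

Lemma dform_contraction (X : cspace R n -> cspace R n) x
    (v : 'M[C]_(n + n, n + n)) : U x ->
  (forall b, cdifferentiable (fun y => (X y 0 b)%:C) x) ->
  dform (scale (fun y => (u y)%:C)
    (Defs.interior (fun y => map_mx (real_complex R) (X y))
       (wedge w (conj_form w)))) x v =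
  \det v * (\det (row_mx (dz_mx R n) (dzbar_mx R n)) * W X x).
Proof.
move=> Ux dX; set d := \det (row_mx _ _).
have dH b : cdifferentiable (fun y => (u y)%:C * (h y * conjc (h y)) * (X y 0 b)%:C) x.
  apply: cdifferentiableM => //; apply: cdifferentiableM; first exact: diff_u.
  apply: cdifferentiableM; first exact: diff_h.
  exact/cdifferentiable_conj/diff_h.
have -> : d * W X x = \sum_(b < n + n) cderive (delta_mx 0 b)
    (fun y => d * ((u y)%:C * (h y * conjc (h y)) * (X y 0 b)%:C)) x.
  rewrite /W mulr_sumr; apply: eq_bigr => b _; rewrite cderiveZ //.
  rewrite /cderive (bigD1 b) //= big1 ?addr0 => [|c cb].
    by rewrite mxE !eqxx mul1r.
  by rewrite mxE (negPf cb) andbF mul0r.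
rewrite -(@sum_divergence R n (n' + n) v) => [|b]; last first.
  by apply: (@cdifferentiableM _ _ (fun=> d)) => //; exact: cdifferentiable_cst.
apply: eq_bigr => i _; congr (_ * _).
have -> : row i v = \sum_j v i j *: delta_mx 0 j.
  by rewrite [LHS]row_sum_delta; apply: eq_bigr => j _; rewrite mxE.
apply: (eq_cderive _ openU Ux) => y Uy; rewrite /scale /=.
rewrite (@wedge_conjE _ _ w y (h y)) => [|v']; last exact: wE.
set c := (u y)%:C * (h y * conjc (h y)).
have -> : \row_j (d * (c * (X y 0 j)%:C)) =
    (d * c) *: map_mx (real_complex R) (X y).
  by apply/rowP => j; rewrite !mxE mulrA.
by rewrite det_col_mxZ /c -/d; ring.
Qed.

(* [W] is real, being a divergence of real functions. *)
Let Im_W X x : Im (W X x) = 0.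
Proof.
rewrite /W raddf_sum /= big1 // => b _; rewrite /cpartial /= /partial.
have -> : (fun y => Im ((u y)%:C * (h y * conjc (h y)) * (X y 0 b)%:C)) =
    (fun=> 0).
  by apply/funext => y; case: (h y) => p q; simpc => /=; ring.
exact: derive_cst.
Qed.

Let XR := real_hamiltonian (fun y => realPoissonR (P y)) u.
Let XI := real_hamiltonian (fun y => realPoissonI (P y)) u.

Let real_hamiltonianE Q y b :
  real_hamiltonian Q u y 0 b = \sum_a Q y a b * partial a u y.
Proof.
rewrite /real_hamiltonian summxE; apply: eq_bigr => a _.
rewrite summxE (bigD1 b) //= big1 ?addr0 => [|c cb].
  by rewrite !mxE !eqxx mulr1.
by rewrite !mxE [b == c]eq_sym (negPf cb) andbF mulr0.
Qed.

Let diff_real_hamiltonian (Q : cspace R n -> 'M[R]_(n + n)) x b : U x ->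
  (forall a c, differentiable (fun y => Q y a c) x) ->
  cdifferentiable (fun y => (real_hamiltonian Q u y 0 b)%:C) x.
Proof.
move=> Ux dQ.
under [X in cdifferentiable X]eq_fun do rewrite real_hamiltonianE rmorph_sum /=.
apply: cdifferentiable_sum => a; apply: cdifferentiable_real.
apply: differentiableM; first exact: dQ.
by case: (smooth_u 2%N) => _ /(_ (delta_mx 0 a)) [+ _]; exact.
Qed.

Let diff_realPoissonR x a b : U x ->
  differentiable (fun y => realPoissonR (P y) a b) x.
Proof.
move=> Ux; rewrite /realPoissonR; under [X in differentiable X _]eq_fun do rewrite mxE.
apply: differentiableM; first exact: differentiable_cst.
rewrite -[a](splitK a) -[b](splitK b).
case: (fintype.split a) => i; case: (fintype.split b) => j /=.
- under [X in differentiable X _]eq_fun do rewrite block_mxEul mxE.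
  exact: (diff_P i j Ux).1.
- under [X in differentiable X _]eq_fun do rewrite block_mxEur mxE.
  exact: (diff_P i j Ux).2.
- under [X in differentiable X _]eq_fun do rewrite block_mxEdl mxE.
  exact: (diff_P i j Ux).2.
under [X in differentiable X _]eq_fun do rewrite block_mxEdr !mxE.
exact: differentiableN (diff_P i j Ux).1.
Qed.

Let diff_realPoissonI x a b : U x ->
  differentiable (fun y => realPoissonI (P y) a b) x.
Proof.
move=> Ux; rewrite /realPoissonI; under [X in differentiable X _]eq_fun do rewrite mxE.
apply: differentiableM; first exact: differentiable_cst.
rewrite -[a](splitK a) -[b](splitK b).
case: (fintype.split a) => i; case: (fintype.split b) => j /=.
- under [X in differentiable X _]eq_fun do rewrite block_mxEul mxE.
  exact: (diff_P i j Ux).2.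
- under [X in differentiable X _]eq_fun do rewrite block_mxEur !mxE.
  exact: differentiableN (diff_P i j Ux).1.
- under [X in differentiable X _]eq_fun do rewrite block_mxEdl !mxE.
  exact: differentiableN (diff_P i j Ux).1.
under [X in differentiable X _]eq_fun do rewrite block_mxEdr !mxE.
exact: differentiableN (diff_P i j Ux).2.
Qed.

Let cderive_u i y : U y ->
  cderive (ddz R i) (fun y => (u y)%:C) y = conjc (f y) * cderive (ddz R i) f y.
Proof.
move=> Uy; have -> : (fun y => (u y)%:C) = f \* (fun y => conjc (f y)).
  by apply/funext => z; rewrite uE.
rewrite cderiveM; [|exact: diff_f|exact/cdifferentiable_conj/diff_f].
rewrite cderive_conj; last exact: diff_f.
by rewrite conj_ddz (holf.2 i y Uy) conjc0 mulr0 addr0 mulrC.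
Qed.

Let real_hamiltonian_RI y b : U y ->
  (XR y 0 b)%:C + 'i * (XI y 0 b)%:C =
  conjc (f y) * \sum_j ddz R j 0 b * Z j y.
Proof.
move=> Uy; rewrite /XR /XI !real_hamiltonianE.
rewrite !rmorph_sum /= mulr_sumr -big_split /=.
transitivity (\sum_a (\sum_j \sum_i ddz R i 0 a * P y i j * ddz R j 0 b) *
    cpartial a (fun y => (u y)%:C) y).
  apply: eq_bigr => a _; rewrite cpartial_real !rmorphM mulrA -mulrDl.
  by rewrite PoissonRDI_entry.
under [LHS]eq_bigr do rewrite mulr_suml.
rewrite exchange_big /= mulr_sumr; apply: eq_bigr => j _.
under [LHS]eq_bigr do rewrite mulr_suml.
rewrite exchange_big /= /Z mulr_sumr mulr_sumr; apply: eq_bigr => i _.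
transitivity (P y i j * ddz R j 0 b * cderive (ddz R i) (fun y => (u y)%:C) y).
  by rewrite /cderive mulr_sumr; apply: eq_bigr => a _; ring.
by rewrite cderive_u //; ring.
Qed.

(** The comparison of the two sides.  The coefficient [c], a product of conjugates
    of holomorphic functions, is constant for every [d/dz^j]. *)
Let W_RI x : U x ->
  W XR x + 'i * W XI x = conjc (f x) ^+ 2 * conjc (h x) * A x.
Proof.
move=> Ux.
have dXR b : cdifferentiable (fun y => (XR y 0 b)%:C) x.
  by apply: diff_real_hamiltonian => // a c; exact: diff_realPoissonR.
have dXI b : cdifferentiable (fun y => (XI y 0 b)%:C) x.
  by apply: diff_real_hamiltonian => // a c; exact: diff_realPoissonI.
have dfb : cdifferentiable (fun y => conjc (f y)) x.
  exact/cdifferentiable_conj/diff_f.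
have dhb : cdifferentiable (fun y => conjc (h y)) x.
  exact/cdifferentiable_conj/diff_h.
pose H y := (u y)%:C * (h y * conjc (h y)).
have dH : cdifferentiable H x.
  apply: cdifferentiableM; first exact: diff_u.
  by apply: cdifferentiableM; first exact: diff_h.
pose F j y := f y * h y * Z j y.
have dF j : cdifferentiable (F j) x.
  apply: cdifferentiableM; last exact: diff_Z.
  by apply: cdifferentiableM; [exact: diff_f|exact: diff_h].
pose c y := conjc (f y) * conjc (f y) * conjc (h y).
have dc : cdifferentiable c x by do 2!apply: cdifferentiableM => //.
have bar0 g j : cdifferentiable g x -> cderive (ddzbar R j) g x = 0 ->
    cderive (ddz R j) (fun y => conjc (g y)) x = 0.
  by move=> dg g0; rewrite cderive_conj // conj_ddz g0 conjc0.
have c0 j : cderive (ddz R j) c x = 0.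
  have f0 := bar0 f j (diff_f Ux) (holf.2 j x Ux).
  have h0 := bar0 h j (diff_h Ux) (dbar_h j Ux).
  rewrite /c cderiveM //; last exact: cdifferentiableM.
  by rewrite cderiveM // f0 h0 !(mul0r, mulr0, addr0).
transitivity (\sum_b cpartial b (fun y => \sum_j ddz R j 0 b * (F j y * c y)) x).
  rewrite /W mulr_sumr -big_split /=; apply: eq_bigr => b _.
  rewrite -cpartialZ; last exact: cdifferentiableM.
  rewrite -cpartialD; first last.
  - apply: (@cdifferentiableM _ _ (fun=> 'i)); first exact: cdifferentiable_cst.
    exact: cdifferentiableM.
  - exact: cdifferentiableM.
  (* the formula for [du/dz^i] holds on [U] only, hence the local congruence *)
  apply: (eq_cpartial _ openU Ux) => y Uy /=.
  rewrite [X in _ + X]mulrCA -mulrDr real_hamiltonian_RI // uE !mulr_sumr.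
  by apply: eq_bigr => j _; rewrite /F /c; ring.
have dFc j : cdifferentiable (fun y => F j y * c y) x by exact: cdifferentiableM.
transitivity (\sum_j cderive (ddz R j) (fun y => F j y * c y) x).
  rewrite /cderive exchange_big /=; apply: eq_bigr => b _.
  rewrite cpartial_sum => [|j]; last first.
    by apply: (@cdifferentiableM _ _ (fun=> _)) => //; exact: cdifferentiable_cst.
  by apply: eq_bigr => j _; rewrite cpartialZ.
rewrite /A mulr_sumr; apply: eq_bigr => j _.
by rewrite cderiveM // c0 mulr0 addr0 mulrC.
Qed.

(** Where [f] vanishes the divergence reduces to [h {f, f} = 0]. *)
Let A_eq0 x : U x -> f x = 0 -> A x = 0.
Proof.
move=> Ux fx.
have skew0 (D : 'I_n -> C) : \sum_i \sum_j P x i j * D i * D j = 0.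
  have Pji i j : P x j i = - P x i j.
    by have /matrixP/(_ i j) := skewP Ux; rewrite !mxE.
  apply/eqP; rewrite -eqNr; apply/eqP.
  rewrite [in RHS]exchange_big -sumrN; apply: eq_bigr => i _.
  rewrite -sumrN; apply: eq_bigr => j _ /=.
  by rewrite (Pji i j) !mulNr mulrAC.
pose D i := cderive (ddz R i) f x.
pose S := \sum_i \sum_j P x i j * D i * D j.
have S0 : S = 0 by exact: skew0.
transitivity (h x * S); last by rewrite S0 mulr0.
rewrite /A /S [in RHS]exchange_big /= mulr_sumr; apply: eq_bigr => j _.
have dfh : cdifferentiable (fun y => f y * h y) x.
  by apply: cdifferentiableM; [exact: diff_f|exact: diff_h].
rewrite cderiveM //; last exact: diff_Z.
rewrite fx !mul0r addr0 cderiveM; [|exact: diff_f|exact: diff_h].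
rewrite fx mul0r addr0 /Z !mulr_sumr.
have alg (p q r s : C) : q * s * (p * r) = s * (p * r * q) by ring.
by apply: eq_bigr => i _; exact: alg.
Qed.

Lemma last_multiplier_chart x : U x ->
  (forall v, del (scale f (Defs.interior (hamiltonian P f) w)) x v = 0) <->
  (forall v, dform (scale (fun y => (u y)%:C)
    (Defs.interior (fun y => map_mx (real_complex R) (XR y))
       (wedge w (conj_form w)))) x v = 0) /\
  (forall v, dform (scale (fun y => (u y)%:C)
    (Defs.interior (fun y => map_mx (real_complex R) (XI y))
       (wedge w (conj_form w)))) x v = 0).
Proof.
move=> Ux.
have dXR b : cdifferentiable (fun y => (XR y 0 b)%:C) x.
  by apply: diff_real_hamiltonian => // a c; exact: diff_realPoissonR.
have dXI b : cdifferentiable (fun y => (XI y 0 b)%:C) x.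
  by apply: diff_real_hamiltonian => // a c; exact: diff_realPoissonI.
have WC X : W X x = (Re (W X x))%:C by rewrite [LHS]complexE Im_W mulr0 addr0.
have d0 := det_dz_dzbar_neq0 R n.
have dformP (X : cspace R n -> cspace R n) :
    (forall b, cdifferentiable (fun y => (X y 0 b)%:C) x) ->
    (forall v, dform (scale (fun y => (u y)%:C)
      (Defs.interior (fun y => map_mx (real_complex R) (X y))
         (wedge w (conj_form w)))) x v = 0) <-> W X x = 0.
  move=> dX; split=> [/(_ 1%:M)|W0 v].
    rewrite dform_contraction // det1 mul1r => /eqP.
    by rewrite mulf_eq0 (negPf d0) => /eqP.
  by rewrite dform_contraction // W0 !mulr0.
have PR := dformP _ dXR; have PI := dformP _ dXI.
split=> [del0|[/PR WR /PI WI] v].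
  have A0 : A x = 0.
    by have := del0 (ddz_mx R n); rewrite del_contraction // ddz_mxK det1 mul1r.
  have := W_RI Ux; rewrite A0 mulr0 (WC XR) (WC XI) => /eq_real_imag [R0 I0].
  by split; [apply/PR; rewrite WC R0|apply/PI; rewrite WC I0].
rewrite del_contraction //.
(* [W_RI] determines [A x] only where [f] does not vanish *)
have [fx|fx] := eqVneq (f x) 0; first by rewrite A_eq0 ?mulr0.
have /esym/eqP := W_RI Ux; rewrite WR WI mulr0 addr0 !mulf_eq0.
by rewrite !conjc_eq0 (negPf fx) (negPf (h_neq0 Ux)) => /eqP ->; rewrite mulr0.
Qed.

End Chart.

(** * The global equivalence *)

Lemma normc_sqr (R : realType) (z : R[i]) :
  ((ComplexField.Normc.normc z) ^+ 2)%:C = z * conjc z.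
Proof. by rewrite -sqr_normc rmorphXn. Qed.

(** In complex dimension [0] there are no coordinate derivatives at all, and both
    conditions hold trivially. *)
Lemma form0_contraction (R : realType) (g : cspace R 0 -> R[i])
    (Z : cspace R 0 -> ctangent R 0) (eta : Defs.form R 0 0) x v :
  del (scale g (Defs.interior Z eta)) x v = 0 /\
  dform (scale g (Defs.interior Z eta)) x v = 0.
Proof.
by rewrite /del /dform !big1 // => i _; rewrite /cderive big_ord0 mulr0.
Qed.

Theorem theorem3p2 (R : realType) (n : nat) (M : complexManifold R n)
    (P : holomorphicPoisson M) (w : holomorphicVolume M)
    (f : M -> complex R) (hf : holomorphic_fun f) :
  holomorphic_last_multiplier w (hamiltonian_field P f) f <->
  real_last_multiplier w (hamiltonian_fieldR P (sqnorm f)) (sqnorm f) /\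
  real_last_multiplier w (hamiltonian_fieldI P (sqnorm f)) (sqnorm f).
Proof.
have open_region (a : atlas_index M) : open (region a) by exact: coord_open.
have smooth_u : smooth_fun (sqnorm f).
  by move=> a; exact: (smooth_sqnorm (open_region a) (hf a).1).
case: n M P w f hf open_region smooth_u => [|n] M P w f hf open_region smooth_u.
  split=> _; last by split=> // a x v _; exact: (form0_contraction _ _ _ _ _).1.
  by split; split=> // a x v _; exact: (form0_contraction _ _ _ _ _).2.
have chart a x := @last_multiplier_chart R n (region a) (P a) (w a)
  (local f a) (local (sqnorm f) a) (open_region a) (@poisson_skew _ _ _ P a)
  (poisson_holomorphic P a) (volume_holomorphic w a) (@volume_neq0 _ _ _ w a)
  (hf a) (smooth_u a) (fun y => normc_sqr _) x.
split=> [[_ H]|[[_ HR] [_ HI]]].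
  by split; split=> // a x v ax;
    have [HR HI] := (chart a x ax).1 (fun v => H a x v ax); [exact: HR|exact: HI].
split=> // a x v ax; apply: (chart a x ax).2; split=> v'; [exact: HR|exact: HI].
Qed.
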